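(* Let $\mathcal{F}=\{f_1,\ldots,f_n\}$ and $\widetilde{\mathcal{F}}=\{\widetilde f_1,\ldots,\widetilde f_n\}$ be two systems with $\mathrm{Dom}(f_i)=\mathrm{Dom}(\widetilde f_i)$ and $\sigma(f_i)=\sigma(\widetilde f_i)$ (equal orientations) for all $1\le i\le n$, and assume that both satisfy the separability hypothesis. Then: (1) $\mathcal{F}$ and $\widetilde{\mathcal{F}}$ are combinatorially equivalent if and only if they have the same kneading sequence. (2) Assume in addition that whenever an interval $(x,y)$ (with $x<y$ real) is a connected component of $\mathbb{R}\setminus\mathrm{cl}(\mathscr{C}_G)$ then $x,y\in\mathscr{C}_G$, and that whenever $(x,y)$ is a connected component of $\mathbb{R}\setminus\mathrm{cl}(\widetilde{\mathscr{C}}_G)$ then $x,y\in\widetilde{\mathscr{C}}_G$. Then $\mathcal{F}$ in $\mathrm{cl}(\mathscr{C}_G)$ is topologically conjugate to $\widetilde{\mathcal{F}}$ in $\mathrm{cl}(\widetilde{\mathscr{C}}_G)$ if and only if $\mathcal{F}$ and $\widetilde{\mathcal{F}}$ have the same kneading sequence.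
   Context: **Systems.** A system is a finite family $\mathcal{F}=\{f_1,\ldots,f_n\}$ of continuous strictly monotone functions $f_i:I_i\to\mathbb{R}$, where $I_i=[c_i^{\ell},c_i^{r}]$ with $c_i^\ell<c_i^r$; $\mathrm{Dom}(f_i)=I_i$. The points $c_i^\ell,c_i^r$ are called turning points. $G$ is the free group on symbols $a_1,\ldots,a_n$, with identity $e$ and word length $|\cdot|$; $S\subset G$ is the free semigroup (with identity $e$) generated by $a_1,\ldots,a_n$; $S^{-1}$ is the set of inverses of elements of $S$. Put $f_{a_i}=f_i$, $f_{a_i^{-1}}=f_i^{-1}$ (with domain $f_i(I_i)$), $f_e=\mathrm{Id}_{\mathbb{R}}$, and for a reduced word $g=x_1x_2\cdots x_m$ put $f_g=f_{x_m}\circ\cdots\circ f_{x_1}$ with its natural domain $\mathrm{Dom}(f_g)$ (possibly empty). For a set $J\subset\mathbb{R}$, $f_g(J)$ means $f_g(J\cap\mathrm{Dom}(f_g))$. $\sigma(f_i)=1$ if $f_i$ is increasing and $-1$ if it is decreasing. $\mathrm{cl}$ denotes closure in $\mathbb{R}$. **Addresses, itineraries, kneading sequences.** The address $D(x)$ of $x\in\mathbb{R}$ records, for each $i$, which of the following five options holds: $x\in\mathrm{int}(I_i)$; $x<c_i^\ell$; $x>c_i^r$; $x=c_i^\ell$; $x=c_i^r$. So $D(x)=D(y)$ iff the same option holds for $x$ and $y$ for every $i$. $G_x=\{g\in G: x\in\mathrm{Dom}(f_g)\}$ and $S_x=G_x\cap S$. The itinerary of $x$ is the function $T_x:G_x\to\{\text{addresses}\}$,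 $T_x(g)=D(f_g(x))$. The kneading sequence of $\mathcal{F}$ is the family $\{T_c\restriction_{S_c}: c\text{ turning point}\}$. Objects of $\widetilde{\mathcal{F}}$ carry a tilde; having the same kneading sequence (when the domains agree) means $S_c=\widetilde S_c$ and $T_c\restriction_{S_c}=\widetilde T_c\restriction_{\widetilde S_c}$ for every turning point $c$. **Critical orbits.** $\mathscr{C}_G=\{f_g(c): c\text{ turning point}, g\in G_c\}$, and $\mathscr{C}_{S^{-1}}=\{f_g(c): c\text{ turning point}, g\in G_c\cap S^{-1}\}$. **Separability hypothesis.** An element $g\in G$ separates $x,y\in\mathbb{R}$ if exactly one of $x,y$ lies in $\mathrm{Dom}(f_g)$, or both lie in $\mathrm{Dom}(f_g)$ and $D(f_g(x))\ne D(f_g(y))$. $\mathcal{F}$ separates points in the past if for any two different generators $a,b$ and any two different points $x\in f_{a^{-1}}(\mathscr{C}_{S^{-1}})$, $y\in f_{b^{-1}}(\mathscr{C}_{S^{-1}})$, some element of $S^{-1}$ separates $x,y$. $\mathcal{F}$ separates the critical orbit in the future if any two different points of $\mathscr{C}_G$ are separated by some element of $S$. $\mathcal{F}$ satisfies the separability hypothesis if it has both properties. **Combinatorial equivalence.** Two systems with $\sigma(f_i)=\sigma(\widetilde f_i)$ for all $i$ are combinatorially equivalent if there is an order preserving bijection $\varphi:\mathscr{C}_G\to\widetilde{\mathscr{C}}_G$ with $\varphi(c_i^\ell)=\widetilde c_i^{\,\ell}$, $\varphi(c_i^r)=\widetilde c_i^{\,r}$ for all $i$, and, for all $g\in G$,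 $\varphi(\mathrm{Dom}(f_g)\cap\mathscr{C}_G)=\mathrm{Dom}(\widetilde f_g)\cap\widetilde{\mathscr{C}}_G$ and $\varphi(f_g(x))=\widetilde f_g(\varphi(x))$ for all $x\in\mathrm{Dom}(f_g)\cap\mathscr{C}_G$. **Topological conjugacy.** $K\subset\mathbb{R}$ is $\mathcal{F}$-invariant if $f_g(K\cap\mathrm{Dom}(f_g))\subset K$ for all $g\in G$. For systems with $\sigma(f_i)=\sigma(\widetilde f_i)$ for all $i$, $K$ $\mathcal{F}$-invariant and $\widetilde K$ $\widetilde{\mathcal{F}}$-invariant, $\mathcal{F}$ in $K$ is topologically conjugate to $\widetilde{\mathcal{F}}$ in $\widetilde K$ if there is an order preserving homeomorphism $\varphi:K\to\widetilde K$ such that for all $g\in G$, $\varphi(K\cap\mathrm{Dom}(f_g))=\widetilde K\cap\mathrm{Dom}(\widetilde f_g)$ and $\varphi(f_g(x))=\widetilde f_g(\varphi(x))$ for all $x\in K\cap\mathrm{Dom}(f_g)$. *)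

(* Defs.v *)
From HB Require Import structures.
From mathcomp Require Import all_boot all_order all_algebra.
From mathcomp Require Import all_classical all_reals all_analysis.

Set Implicit Arguments.
Unset Strict Implicit.
Unset Printing Implicit Defensive.

Import Order.TTheory GRing.Theory Num.Theory.
Import numFieldNormedType.Exports.

Local Open Scope classical_set_scope.
Local Open Scope ring_scope.

(* [(i, true)] is the generator a_i and [(i, false)] is its inverse. *)
Definition letter (n : nat) := ('I_n * bool)%type.

Definition inv_letter n (x : letter n) : letter n := (x.1, ~~ x.2).

Definition reduced n (w : seq (letter n)) : bool :=
  sorted (fun x y => y != inv_letter x) w.

(* The free group on a_1, ..., a_n, in its reduced-word model. *)
Record free_group (n : nat) := FreeGroup {
  word :> seq (letter n);
  word_reduced : reduced word
}.

Lemma reduced_inv n (w : seq (letter n)) :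
  reduced w -> reduced (rev (map (@inv_letter n) w)).
Proof.
rewrite /reduced rev_sorted sorted_map; apply: sub_sorted => x y /=.
rewrite /inv_letter /=; apply: contraNN => /eqP ->.
by case: y => j c /=; rewrite negbK.
Qed.

Definition fg_inv n (g : free_group n) : free_group n :=
  FreeGroup (reduced_inv (word_reduced g)).

Definition fg_gen n (i : 'I_n) : free_group n :=
  @FreeGroup n [:: (i, true)] isT.

(* The free semigroup with identity generated by a_1, ..., a_n: a word without
   inverse letters is automatically reduced, and products of such words are
   concatenations. *)
Definition semigroup n : set (free_group n) :=
  [set g | all (fun x : letter n => x.2) g].

Definition semigroup_inv n : set (free_group n) := @fg_inv n @` @semigroup n.

(* Each f_i is a total function of which only the restriction to
   [lend i, rend i] is relevant. *)
Record system (R : realType) (n : nat) := System {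
  lend : 'I_n -> R;
  rend : 'I_n -> R;
  fn : 'I_n -> R -> R;
  lend_lt_rend : forall i, lend i < rend i;
  fn_continuous : forall i, {within `[lend i, rend i], continuous (fn i)};
  fn_monotone : forall i,
    {in `[lend i, rend i] &, {homo fn i : x y / x < y}} \/
    {in `[lend i, rend i] &, {homo fn i : x y /~ x < y}}
}.

Section Systems.
Variables (R : realType) (n : nat).
Implicit Types (F : system R n) (g : free_group n) (K : set R).

Definition dom F (i : 'I_n) : set R := `[lend F i, rend F i]%classic.

Definition sigma F (i : 'I_n) : int :=
  if `[< {in dom F i &, {homo fn F i : x y / x < y}} >] then 1 else -1.

Definition turning F : set R :=
  [set c | exists i, c = lend F i \/ c = rend F i].

Definition letter_dom F (x : letter n) : set R :=
  if x.2 then dom F x.1 else fn F x.1 @` dom F x.1.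

Definition letter_fun F (x : letter n) : R -> R :=
  if x.2 then fn F x.1 else 'pinv_(fun=> 0) (dom F x.1) (fn F x.1).

(* The letters of a word act from left to right:
   f_{x_1 ... x_m} = f_{x_m} \o ... \o f_{x_1}. *)
Fixpoint word_dom F (w : seq (letter n)) : set R :=
  if w is x :: w' then letter_dom F x `&` letter_fun F x @^-1` word_dom F w'
  else setT.

Fixpoint word_fun F (w : seq (letter n)) (z : R) : R :=
  if w is x :: w' then word_fun F w' (letter_fun F x z) else z.

Definition Dom F g : set R := word_dom F g.

(* The value of f_g at z; it is meaningless unless z lies in [Dom F g]. *)
Definition act F g (z : R) : R := word_fun F g z.

Definition act_image F g (J : set R) : set R := act F g @` (J `&` Dom F g).

Variant position := Interior | Below | Above | LeftEnd | RightEnd.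

Definition address F (x : R) : {ffun 'I_n -> position} :=
  [ffun i => if x < lend F i then Below
             else if x == lend F i then LeftEnd
             else if x < rend F i then Interior
             else if x == rend F i then RightEnd
             else Above].

Definition G_at F (x : R) : set (free_group n) := [set g | Dom F g x].

Definition S_at F (x : R) : set (free_group n) := G_at F x `&` @semigroup n.

(* The itinerary T_x is the restriction of this function to [G_at F x]. *)
Definition itinerary F (x : R) g : {ffun 'I_n -> position} :=
  address F (act F g x).

Definition same_kneading F F' : Prop :=
  forall c, turning F c ->
    S_at F c = S_at F' c /\
    (forall g, S_at F c g -> itinerary F c g = itinerary F' c g).

Definition orbit_G F : set R :=
  [set y | exists c g, [/\ turning F c, G_at F c g & y = act F g c]].

Definition orbit_Sinv F : set R :=
  [set y | exists c g, [/\ turning F c, (G_at F c `&` @semigroup_inv n) g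
                         & y = act F g c]].

Definition separates F g (x y : R) : Prop :=
  [\/ Dom F g x /\ ~ Dom F g y,
      ~ Dom F g x /\ Dom F g y
    | [/\ Dom F g x, Dom F g y & address F (act F g x) <> address F (act F g y)]].

Definition separates_past F : Prop :=
  forall (a b : 'I_n), a != b ->
  forall x y, act_image F (fg_inv (fg_gen a)) (orbit_Sinv F) x ->
              act_image F (fg_inv (fg_gen b)) (orbit_Sinv F) y ->
  x != y -> exists2 g, @semigroup_inv n g & separates F g x y.

Definition separates_future F : Prop :=
  forall x y, orbit_G F x -> orbit_G F y -> x != y ->
  exists2 g, @semigroup n g & separates F g x y.

Definition separability F : Prop := separates_past F /\ separates_future F.

Definition same_orientation F F' : Prop := forall i, sigma F i = sigma F' i.

Definition comb_equivalent F F' : Prop :=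
  same_orientation F F' /\
  exists phi : R -> R,
    [/\ set_bij (orbit_G F) (orbit_G F') phi,
        {in orbit_G F &, {homo phi : x y / x <= y}},
        (forall i, phi (lend F i) = lend F' i /\ phi (rend F i) = rend F' i),
        (forall g, phi @` (Dom F g `&` orbit_G F) = Dom F' g `&` orbit_G F')
      & (forall g x, Dom F g x -> orbit_G F x ->
           phi (act F g x) = act F' g (phi x))].

Definition invariant_set F K : Prop := forall g, act_image F g K `<=` K.

Definition homeomorphism (K K' : set R) (phi : R -> R) : Prop :=
  [/\ set_bij K K' phi, {within K, continuous phi}
    & {within K', continuous ('pinv_(fun=> 0) K phi)}].

Definition top_conjugate F K F' K' : Prop :=
  [/\ same_orientation F F', invariant_set F K, invariant_set F' K' &
  exists phi : R -> R,
    [/\ homeomorphism K K' phi,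
        {in K &, {homo phi : x y / x <= y}},
        (forall g, phi @` (K `&` Dom F g) = K' `&` Dom F' g)
      & (forall g x, K x -> Dom F g x -> phi (act F g x) = act F' g (phi x))]].

(* A nonempty open interval is a connected component of a set A when it is the
   connected component in A of some point of A. *)
Definition gap_ends_in_orbit F : Prop :=
  forall x y : R, x < y ->
    (exists2 z : R, (~` closure (orbit_G F)) z &
       connected_component (~` closure (orbit_G F)) z = `]x, y[%classic) ->
    orbit_G F x /\ orbit_G F y.

End Systems.

(* Main.v *)
Require Import Defs.
From mathcomp Require Import all_boot all_order all_algebra.
From mathcomp Require Import all_classical all_reals all_analysis.
From mathcomp Require Import lra.

Import Order.TTheory GRing.Theory Num.Theory.
Import numFieldNormedType.Exports.

(** Follow a turning point along the same word in both systems and keep the pair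
    of points (x, x') so obtained; the two systems have equivalent critical
    orbits as soon as any two such pairs are ordered in the same way in both
    coordinates.  Equal kneading sequences give this for forward orbits against
    turning points.  Pulling back, backward orbits compare correctly with forward
    orbits, hence, by separation in the past, with each other.  A pair that
    compares correctly with the backward orbits of the turning points keeps doing
    so along forward steps, so separation in the future orders all such pairs
    correctly; then backward steps preserve the property too, and it holds
    along every word.  For the closures: under the gap hypothesis every point of
    cl(C_G) outside C_G is a limit of C_G from both sides, so the order
    isomorphism of the orbits has exactly one order preserving extension, and an
    order isomorphism between closed sets of reals is a homeomorphism. *)

(** * Words and letters *)

Section Words.
Set Implicit Arguments.
Unset Strict Implicit.
Variable n : nat.
Implicit Types (l : letter n) (w : seq (letter n)) (g : free_group n).

Lemma inv_letterK : involutive (@inv_letter n).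
Proof. by case=> i b; rewrite /inv_letter /= negbK. Qed.

(** Adjacent letters of equal sign cannot cancel, so a word in one sign is an element of the group
    as it stands. *)
Lemma reduced_signed b w : all (fun l => l.2 == b) w -> reduced w.
Proof.
rewrite /reduced; case: w => //= l w; elim: w l => //= m w IH l /and3P[lb mb wb].
rewrite IH ?mb // andbT; apply/eqP => ml.
by move: mb lb; rewrite ml /= => /eqP <-; case: l.2.
Qed.

Lemma reduced_rcons2 w l l' :
  reduced (rcons (rcons w l) l') = reduced (rcons w l) && (l' != inv_letter l).
Proof.
by rewrite /reduced; case: w => [|a w] /=; rewrite ?andbT // rcons_path last_rcons.
Qed.

Lemma reduced_rcons w l : reduced (rcons w l) -> reduced w.
Proof. by rewrite /reduced; case: w => [|a w] //=; rewrite rcons_path => /andP[]. Qed.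

Lemma semigroup_word w : all (fun l => l.2) w ->
  exists2 g, semigroup g & word g = w.
Proof.
move=> wp; have wr : reduced w.
  by apply: (@reduced_signed true); apply: sub_all wp => l ->.
by exists (FreeGroup wr).
Qed.

Lemma semigroup_inv_word w : all (fun l => ~~ l.2) w ->
  exists2 g, semigroup_inv g & word g = w.
Proof.
move=> wn; have : all (fun l => l.2) (rev (map (@inv_letter n) w)).
  by rewrite all_rev all_map.
case/semigroup_word => h hp hw; exists (fg_inv h); first by exists h.
by rewrite /= hw map_rev revK -map_comp map_id_in // => l _; apply: inv_letterK.
Qed.

Lemma semigroup_inv_neg g : semigroup_inv g -> all (fun l => ~~ l.2) (word g).
Proof.
case=> h hp <- /=; rewrite all_rev all_map; apply: sub_all hp => l /=.
by rewrite negbK.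
Qed.

End Words.

(** * Letters of one system as strictly monotone maps of closed intervals *)

Section OneSystem.
Local Open Scope classical_set_scope.
Local Open Scope ring_scope.
Set Implicit Arguments.
Unset Strict Implicit.
Variables (R : realType) (n : nat) (F : system R n).
Implicit Types (l : letter n) (w : seq (letter n)) (i : 'I_n) (x y z : R).

Definition increasing i : bool :=
  `[< {in dom F i &, {homo fn F i : x y / x < y}} >].

Lemma sigmaE i : sigma F i = if increasing i then 1 else -1.
Proof. by []. Qed.

Lemma dom_lend i : dom F i (lend F i).
Proof. by rewrite /dom /= in_itv /= lexx ltW // lend_lt_rend. Qed.

Lemma dom_rend i : dom F i (rend F i).
Proof. by rewrite /dom /= in_itv /= lexx ltW // lend_lt_rend. Qed.

Lemma fn_lt i x y : dom F i x -> dom F i y ->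
  (fn F i x < fn F i y) = (if increasing i then x < y else y < x).
Proof.
rewrite /increasing => dx dy; have [fmon|fmon] := fn_monotone F i.
  rewrite asboolT; last by move=> u v /set_mem du /set_mem dv; apply: fmon.
  case: (ltgtP x y) => [xy|yx|->]; last by rewrite ltxx.
    exact: fmon.
  by apply/negbTE; rewrite -leNgt ltW // fmon.
rewrite asboolF => [|fmon'].
  case: (ltgtP y x) => [xy|yx|->]; last by rewrite ltxx.
    exact: fmon.
  by apply/negbTE; rewrite -leNgt ltW // fmon.
have := fmon' _ _ (mem_set (dom_lend i)) (mem_set (dom_rend i)) (lend_lt_rend F i).
by rewrite ltNge ltW // fmon ?lend_lt_rend //; [exact: dom_rend|exact: dom_lend].
Qed.

Lemma fn_inj i : {in dom F i &, injective (fn F i)}.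
Proof.
move=> x y /set_mem dx /set_mem dy fxy.
have := fn_lt dx dy; have := fn_lt dy dx; rewrite fxy ltxx.
by case: increasing; case: (ltgtP x y).
Qed.

(** An inverse letter has the image of an interval as its domain; the lower end of that image comes
    from [rend] when the map decreases. *)
Definition letter_lo l : R :=
  if l.2 then lend F l.1
  else fn F l.1 (if increasing l.1 then lend F l.1 else rend F l.1).

Definition letter_hi l : R :=
  if l.2 then rend F l.1
  else fn F l.1 (if increasing l.1 then rend F l.1 else lend F l.1).

Lemma letter_domE l : letter_dom F l = `[letter_lo l, letter_hi l]%classic.
Proof.
case: l => i [] //=; rewrite /letter_dom /letter_lo /letter_hi /=.
apply/seteqP; split=> [_ [x dx <-]|y] /=.
  have dl := dom_lend i; have dr := dom_rend i.
  rewrite in_itv /= !leNgt.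
  case E : (increasing i); rewrite !fn_lt // E -!leNgt.
    by move: dx; rewrite /dom /= in_itv.
  by move: dx; rewrite /dom /= in_itv /= andbC.
rewrite in_itv /= => yi.
have [|c ci <-] := @IVT _ (fn F i) _ _ y (ltW (lend_lt_rend F i)) (@fn_continuous _ _ F i).
  case/andP: yi; case: increasing => y1 y2.
    by rewrite ge_min y1 le_max y2 orbT.
  by rewrite ge_min y1 le_max y2 orbT.
by exists c.
Qed.

Lemma letter_domP l x : letter_dom F l x <-> letter_lo l <= x <= letter_hi l.
Proof. by rewrite letter_domE /= in_itv. Qed.

Lemma letter_funK l x : letter_dom F l x ->
  letter_fun F (inv_letter l) (letter_fun F l x) = x.
Proof.
case: l => i [] /=; rewrite /letter_dom /letter_fun /= => dx.
  by rewrite pinvKV ?inE //; apply: fn_inj.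
by rewrite pinvK // inE.
Qed.

Lemma letter_fun_dom l x : letter_dom F l x ->
  letter_dom F (inv_letter l) (letter_fun F l x).
Proof.
case: l => i [] /=; rewrite /letter_dom /letter_fun /=; first by exists x.
by case=> y dy <-; rewrite pinvKV ?inE //; apply: fn_inj.
Qed.

Lemma letter_lt l x y : letter_dom F l x -> letter_dom F l y ->
  (letter_fun F l x < letter_fun F l y) =
  (if increasing l.1 then x < y else y < x).
Proof.
move=> dx dy; case: l dx dy => i [] dx dy; first exact: fn_lt.
have /= := letter_fun_dom dx; have /= := letter_fun_dom dy.
move: (letter_funK dx) (letter_funK dy).
set u := letter_fun F _ x; set v := letter_fun F _ y => <- <-.
rewrite /letter_dom /letter_fun /= => dv du; rewrite !fn_lt //.
by case: increasing.
Qed.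

Lemma word_dom_cat w w' z :
  word_dom F (w ++ w') z <-> word_dom F w z /\ word_dom F w' (word_fun F w z).
Proof.
elim: w z => [|l w IH] z /=; first by split=> [|[]].
by rewrite /setI /= IH; tauto.
Qed.

Lemma word_fun_cat w w' z : word_fun F (w ++ w') z = word_fun F w' (word_fun F w z).
Proof. by elim: w z => /=. Qed.

Lemma word_dom_rcons w l z :
  word_dom F (rcons w l) z <-> word_dom F w z /\ letter_dom F l (word_fun F w z).
Proof. by rewrite -cats1 word_dom_cat /= /setI /=; tauto. Qed.

Lemma word_fun_rcons w l z :
  word_fun F (rcons w l) z = letter_fun F l (word_fun F w z).
Proof. by rewrite -cats1 word_fun_cat. Qed.

Lemma orbit_turning c : turning F c -> orbit_G F c.
Proof. by move=> tc; exists c, (@FreeGroup n [::] isT). Qed.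

Lemma orbit_lend i : orbit_G F (lend F i).
Proof. by apply: orbit_turning; exists i; left. Qed.

Lemma orbit_rend i : orbit_G F (rend F i).
Proof. by apply: orbit_turning; exists i; right. Qed.

Lemma orbit_letter l x : orbit_G F x -> letter_dom F l x ->
  orbit_G F (letter_fun F l x).
Proof.
case=> c [[w wr]] [tc]; rewrite /G_at /Dom /act /= => wc -> {x}.
have [m'|] := boolP (reduced (rcons w l)).
  move=> lx; exists c, (FreeGroup m'); split=> //; last by rewrite /act /= word_fun_rcons.
  by rewrite /G_at /Dom /=; apply/word_dom_rcons.
(* The extended word is not reduced: the new letter cancels the last one, and the word without that
   last letter already leads to the point. *)
case/lastP: w wr wc => [|w m] wr // wc; rewrite reduced_rcons2 wr /= negbK => /eqP -> lx.
have wr' := reduced_rcons wr; move/word_dom_rcons: wc => [wc mx].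
by exists c, (FreeGroup wr'); split; rewrite // word_fun_rcons letter_funK.
Qed.

Lemma orbit_word w x : orbit_G F x -> word_dom F w x -> orbit_G F (word_fun F w x).
Proof.
elim: w x => [|l w IH] x //= ox [lx wx].
by apply: IH => //; apply: orbit_letter.
Qed.

Lemma orbit_lo l : orbit_G F (letter_lo l).
Proof.
case: l => i [] /=; first exact: orbit_lend.
rewrite /letter_lo /=; case: increasing; apply: (@orbit_letter (i, true)).
- exact: orbit_lend. - exact: dom_lend. - exact: orbit_rend. - exact: dom_rend.
Qed.

Lemma orbit_hi l : orbit_G F (letter_hi l).
Proof.
case: l => i [] /=; first exact: orbit_rend.
rewrite /letter_hi /=; case: increasing; apply: (@orbit_letter (i, true)).
- exact: orbit_rend. - exact: dom_rend. - exact: orbit_lend. - exact: dom_lend.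
Qed.

(** The inverse of the last letter applies at the point; for the empty word, a turning point lies in
    its own interval. Hence finitely many letter domains cover the orbit. *)
Lemma orbit_in_letter_dom x : orbit_G F x -> exists l, letter_dom F l x.
Proof.
case=> c [[w wr]] [[i ci]]; rewrite /G_at /Dom /act /= => wc ->.
case/lastP: w wc {wr} => [|w l] /=; first exists (i, true).
  by case: ci => ->; [exact: dom_lend|exact: dom_rend].
move/word_dom_rcons => [_ lx]; exists (inv_letter l).
by rewrite word_fun_rcons; apply: letter_fun_dom.
Qed.

End OneSystem.

(** * Order compatibility of pairs of points *)

Section Pairs.
Local Open Scope classical_set_scope.
Local Open Scope ring_scope.
Set Implicit Arguments.
Unset Strict Implicit.
Variables (R : realType).
Implicit Types (p q e : R * R).

(** Both strict comparisons together also settle equality, so pairwise compatible pairs form the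
    graph of an increasing injection. *)
Definition ord p q : Prop :=
  (p.1 < q.1) = (p.2 < q.2) /\ (q.1 < p.1) = (q.2 < p.2).

Lemma ord_sym p q : ord p q -> ord q p.
Proof. by case. Qed.

Lemma ord_swap p q : ord p q <-> ord (p.2, p.1) (q.2, q.1).
Proof. by rewrite /ord /=; split=> -[-> ->]. Qed.

(** If [e.1] lay between the first coordinates, possibly equal to one of them, the comparisons with
    [e] would chain to the same order of [p] and [q] in both coordinates. In the conclusion [ord] is
    used inside one system: [p.1] and [q.1] have the same position relative to [e.1]. *)
Lemma not_ord_between p q e : ~ ord p q -> ord p e -> ord q e ->
  ord (p.1, q.1) (e.1, e.1).
Proof.
case: p q e => [x x'] [y y'] [u u']; rewrite /ord /= => npq [p1 p2] [q1 q2].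
case: (ltgtP x y) npq => [xy|yx|->] npq //.
- have yx' : y' <= x'.
    by rewrite leNgt; apply/negP => xy'; apply: npq; rewrite xy' ltNge ltW //= ltNge ltW.
  split; apply/idP/idP.
  + by rewrite p1 q1; apply: le_lt_trans.
  + exact: lt_trans.
  + by move=> /lt_trans; apply.
  + by rewrite p2 q2 => /lt_le_trans; apply.
- have xy' : x' <= y'.
    by rewrite leNgt; apply/negP => yx'; apply: npq; rewrite yx' ltNge ltW //= ltNge ltW.
  split; apply/idP/idP.
  + exact: lt_trans.
  + by rewrite p1 q1; apply: le_lt_trans.
  + by rewrite p2 q2 => /lt_le_trans; apply.
  + by move=> /lt_trans; apply.
Qed.

Lemma ord_eq p q : ord p q -> (p.1 == q.1) = (p.2 == q.2).
Proof. by case=> h1 h2; rewrite !eq_le !leNgt h1 h2. Qed.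

Lemma ord_functional p q : ord p q -> p.1 = q.1 -> p.2 = q.2.
Proof. by move=> /ord_eq h pq; apply/eqP; rewrite -h pq. Qed.

Lemma ord_injective p q : ord p q -> p.2 = q.2 -> p.1 = q.1.
Proof. by move=> /ord_eq h pq; apply/eqP; rewrite h pq. Qed.

Variables (n : nat) (F F' : system R n).
Implicit Types (l : letter n) (w : seq (letter n)) (i : 'I_n).

Definition steppable l p : Prop := letter_dom F l p.1 /\ letter_dom F' l p.2.

Definition step l p : R * R := (letter_fun F l p.1, letter_fun F' l p.2).

Definition lo_pair l : R * R := (letter_lo F l, letter_lo F' l).

Definition hi_pair l : R * R := (letter_hi F l, letter_hi F' l).

Definition ord_ends l p : Prop := ord p (lo_pair l) /\ ord p (hi_pair l).

Lemma ord_ends_dom l p : ord_ends l p ->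
  letter_dom F l p.1 <-> letter_dom F' l p.2.
Proof. by case=> -[h1 _] [_ h2]; rewrite !letter_domP !leNgt h1 h2. Qed.

Lemma ord_ends_steppable l p : ord_ends l p -> letter_dom F l p.1 -> steppable l p.
Proof. by move=> /ord_ends_dom h ?; split=> //; apply/h. Qed.

Lemma steppable_step l p : steppable l p -> steppable (inv_letter l) (step l p).
Proof. by case=> h h'; split; [exact: (letter_fun_dom h)|exact: (letter_fun_dom h')]. Qed.

Lemma stepK l p : steppable l p -> step (inv_letter l) (step l p) = p.
Proof. by case: p => x x' [? ?]; rewrite /step /= !letter_funK. Qed.

(** An address is the list of comparisons with the turning points. Taking the same system twice
    gives a criterion for two points of one system to share an address. *)
Lemma address_ord p :
  (forall i, ord_ends (i, true) p) <-> address F p.1 = address F' p.2.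
Proof.
split=> [h|/ffunP h i].
  apply/ffunP => i; rewrite !ffunE; case: (h i) => h1 h2.
  by rewrite (ord_eq h1) (ord_eq h2) h1.1 h2.1.
have := h i; have := lend_lt_rend F i; have := lend_lt_rend F' i.
rewrite !ffunE /ord_ends /ord /lo_pair /hi_pair /letter_lo /letter_hi /=.
case: p {h} => x x' /=.
case: (ltgtP x (lend F i)) => [xl|xl|->]; case: (ltgtP x' (lend F' i)) => [xl'|xl'|->];
  case: (ltgtP x (rend F i)) => [xr|xr|xr]; case: (ltgtP x' (rend F' i)) => [xr'|xr'|xr'] // e' e _;
  first [by rewrite ?e ?e' ?(lt_gtF e) ?(lt_gtF e') | exfalso; lra].
Qed.

Hypothesis same_increasing : forall i, increasing F i = increasing F' i.

Lemma ord_steps l p q : steppable l p -> steppable l q ->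
  ord (step l p) (step l q) <-> ord p q.
Proof.
case=> p1 p2 [q1 q2]; rewrite /ord /= !letter_lt // same_increasing.
by case: increasing; split; case.
Qed.

(* Either [q] can be stepped back and the comparison is the one of [p] with that
   point, or [q] lies outside the image of [l], on a side given by the ends. *)
Lemma ord_step l p q : steppable l p -> ord_ends (inv_letter l) q ->
  (steppable (inv_letter l) q -> ord p (step (inv_letter l) q)) ->
  ord (step l p) q.
Proof.
move=> lp eq pq; have slp := steppable_step lp.
have [qd|] := pselect (letter_dom F (inv_letter l) q.1).
  have sq := ord_ends_steppable eq qd.
  apply/(ord_steps slp sq); rewrite stepK //; exact: pq.
move/letter_domP => nq; case: eq => -[e1 e2] [e3 e4].
have [/letter_domP/andP[p1 p2] /letter_domP/andP[p3 p4]] := slp.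
move: p1 p2 p3 p4 nq e1 e2 e3 e4; rewrite /=.
set x := letter_fun F l _; set x' := letter_fun F' l _.
set a := letter_lo F _; set b := letter_hi F _.
set a' := letter_lo F' _; set b' := letter_hi F' _.
case: q {pq} => y y' /= p1 p2 p3 p4 /negP; rewrite negb_and -!ltNge.
case/orP => ny e1 e2 e3 e4; rewrite /ord /=.
  have ny' : y' < a' by rewrite -e1.
  have h := lt_le_trans ny p1; have h' := lt_le_trans ny' p3.
  by rewrite h h' (lt_gtF h) (lt_gtF h').
have ny' : b' < y' by rewrite -e4.
have h := le_lt_trans p2 ny; have h' := le_lt_trans p4 ny'.
by rewrite h h' (lt_gtF h) (lt_gtF h').
Qed.

End Pairs.

(** * Compatibility from separating words *)

Section Separation.
Local Open Scope classical_set_scope.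
Local Open Scope ring_scope.
Set Implicit Arguments.
Unset Strict Implicit.
Variables (R : realType) (n : nat).
Implicit Types (F : system R n) (p q : R * R) (X : set (R * R)).

(* Following the two points along a separating word, they are compared with a
   common pair of endpoints before they leave [X], in the same way for both
   systems. *)
Lemma ord_separated F F' (b : bool) X
    (same_increasing : forall i, increasing F i = increasing F' i)
    (X_step : forall l p, l.2 = b -> X p -> steppable F F' l p -> X (step F F' l p))
    (X_turn : forall p i, X p -> ord_ends F F' (i, true) p)
    (X_ends : forall p i, X p -> ord_ends F F' (i, b) p)
    (g : free_group n) p q :
  all (fun l => l.2 == b) (word g) -> X p -> X q -> separates F g p.1 q.1 ->
  ord p q.
Proof.
move=> gb Xp Xq sep; apply: contrapT => npq; move: sep.
rewrite /separates /Dom /act; move: (word g) gb => {g} w.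
elim: w p q Xp Xq npq => [|[i c] w IH] p q Xp Xq npq /=.
  move=> _ [[_ h]|[h _]|[_ _ h]]; [by case: h|by case: h|case: h].
  (* The two first coordinates are treated as one pair for two copies of [F]. *)
  apply/(address_ord F F (p.1, q.1)) => i; case: (X_turn _ i Xp) => p1 p2.
  have [q1 q2] := X_turn _ i Xq.
  by split; [exact: (not_ord_between npq p1 q1)|exact: (not_ord_between npq p2 q2)].
case/andP=> /eqP cb wb; subst c; set l := (i, b).
have dom_pq : letter_dom F l p.1 <-> letter_dom F l q.1.
  have [p1 p2] := X_ends _ i Xp; have [q1 q2] := X_ends _ i Xq.
  apply: (@ord_ends_dom _ _ F F l (p.1, q.1)).
  by split; [exact: (not_ord_between npq p1 q1)|exact: (not_ord_between npq p2 q2)].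
have [dp|ndp] := pselect (letter_dom F l p.1); last first.
  have ndq : ~ letter_dom F l q.1 by move/dom_pq.
  by case; [case; case|case=> _; case|case; case].
have sp := ord_ends_steppable (X_ends _ i Xp) dp.
have sq := ord_ends_steppable (X_ends _ i Xq) (dom_pq.1 dp).
have := IH _ _ (X_step l p erefl Xp sp) (X_step l q erefl Xq sq) _ wb.
(* Incompatibility passes to the images, so the induction hypothesis applies to them. *)
have npq' : ~ ord (step F F' l p) (step F F' l q) by move/(ord_steps same_increasing sp sq).
move=> /(_ npq') IHw sep; apply: IHw; have [_ _] := (sp, sq).
case: sep => [[[dp' wp] nq]|[np [dq' wq]]|[[_ wp] [_ wq] a]].
- by apply: Or31; split=> // wq; apply: nq; split=> //; apply/dom_pq.
- by apply: Or32; split=> // wp; apply: np; split.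
- exact: Or33.
Qed.

(** A difference of first coordinates is detected in [F]; if only the second coordinates differ, the
    argument runs with the systems exchanged. *)
Lemma ord_separation F F' (b : bool) X
    (same_increasing : forall i, increasing F i = increasing F' i)
    (X_step : forall l p, l.2 = b -> X p -> steppable F F' l p -> X (step F F' l p))
    (X_turn : forall p i, X p -> ord_ends F F' (i, true) p)
    (X_ends : forall p i, X p -> ord_ends F F' (i, b) p) p q :
  X p -> X q ->
  (p.1 != q.1 ->
   exists2 g : free_group n, all (fun l => l.2 == b) (word g) & separates F g p.1 q.1) ->
  (p.2 != q.2 ->
   exists2 g : free_group n, all (fun l => l.2 == b) (word g) & separates F' g p.2 q.2) ->
  ord p q.
Proof.
move=> Xp Xq s1 s2; have [e1|/s1[g gb]] := eqVneq p.1 q.1; last first.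
  exact: (@ord_separated F F' b X _ _ _ _ g).
have [e2|/s2[g gb s]] := eqVneq p.2 q.2; first by rewrite /ord e1 e2 !ltxx.
apply/ord_swap.
apply: (@ord_separated F' F b [set r | X (r.2, r.1)] _ _ _ _ g) => //.
- move=> l [x' x] lb /= Xx [d' d]; exact: (X_step l (x, x')).
- by move=> [x' x] i /= /(X_turn _ i) [/ord_swap ? /ord_swap ?]; split.
- by move=> [x' x] i /= /(X_ends _ i) [/ord_swap ? /ord_swap ?]; split.
- by rewrite /= -surjective_pairing.
- by rewrite /= -surjective_pairing.
Qed.

End Separation.

(** * From the kneading sequence to the order of the critical orbits *)

Section Kneading.
Local Open Scope classical_set_scope.
Local Open Scope ring_scope.
Set Implicit Arguments.
Unset Strict Implicit.
Variables (R : realType) (n : nat) (F F' : system R n).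
Implicit Types (p q : R * R) (l : letter n) (i : 'I_n) (s : pred (letter n)).
Hypothesis same_increasing : forall i, increasing F i = increasing F' i.
Hypothesis same_lend : forall i, lend F i = lend F' i.
Hypothesis same_rend : forall i, rend F i = rend F' i.

Notation step := (step F F').
Notation steppable := (steppable F F').
Notation lo_pair := (lo_pair F F').
Notation hi_pair := (hi_pair F F').
Notation ord_ends := (ord_ends F F').

(** Words need not be reduced, but each letter must apply in both systems. The predicate [s] will
    select the forward letters, the backward letters, or all of them. *)
Inductive reach s : R * R -> Prop :=
| reach_lend i : reach s (lend F i, lend F' i)
| reach_rend i : reach s (rend F i, rend F' i)
| reach_step l p : s l -> reach s p -> steppable l p -> reach s (step l p).

Lemma reach_word s p : reach s p -> exists c w,
  [/\ turning F c /\ turning F' c, all s w, word_dom F w c, word_dom F' w c &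
      p = (word_fun F w c, word_fun F' w c)].
Proof.
elim=> [i|i|l {}p sl _ [c [w [tc sw wc wc' ->]]] [lp lp']].
- exists (lend F i), [::]; split=> //; last by rewrite /= same_lend.
  by split; exists i; left.
- exists (rend F i), [::]; split=> //; last by rewrite /= same_rend.
  by split; exists i; right.
- exists c, (rcons w l); split=> //; first by rewrite all_rcons sl.
  + by apply/word_dom_rcons.
  + by apply/word_dom_rcons.
  + by rewrite !word_fun_rcons.
Qed.

Lemma reach_orbit s p : reach s p -> orbit_G F p.1 /\ orbit_G F' p.2.
Proof.
case/reach_word => c [w [[tc tc'] _ wc wc' ->]] /=.
by split; apply: orbit_word => //; apply: orbit_turning.
Qed.

Lemma reach_neg_orbit_Sinv p : reach (fun l => ~~ l.2) p ->
  orbit_Sinv F p.1 /\ orbit_Sinv F' p.2.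
Proof.
case/reach_word => c [w [[tc tc'] /semigroup_inv_word[g gn gw] wc wc' ->]] /=.
by split; exists c, g; rewrite /G_at /Dom /act /setI /= gw.
Qed.

(** An end of the domain of an inverse letter is one forward step from a turning point, the same end
    in both systems because orientations agree. *)
Lemma reach_lo s : (forall i, s (i, true)) -> forall l, reach s (lo_pair l).
Proof.
move=> st [i []]; first exact: reach_lend.
rewrite /lo_pair /letter_lo /= -same_increasing.
case: increasing; apply: (@reach_step s (i, true) (_, _)) => //.
- exact: reach_lend. - by split; apply: dom_lend.
- exact: reach_rend. - by split; apply: dom_rend.
Qed.

Lemma reach_hi s : (forall i, s (i, true)) -> forall l, reach s (hi_pair l).
Proof.
move=> st [i []]; first exact: reach_rend.
rewrite /hi_pair /letter_hi /= -same_increasing.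
case: increasing; apply: (@reach_step s (i, true) (_, _)) => //.
- exact: reach_rend. - by split; apply: dom_rend.
- exact: reach_lend. - by split; apply: dom_lend.
Qed.

Hypothesis kneading : same_kneading F F'.

(** The kneading sequence enters here: along forward words the addresses agree, and they record the
    comparisons with turning points. *)
Lemma reach_pos_turning p i : reach (fun l => l.2) p -> ord_ends (i, true) p.
Proof.
move=> rp; move: i; apply/address_ord.
case/reach_word: rp => c [w [[tc _] /semigroup_word[g gp <-] wc _ ->]].
by have [_ h] := kneading tc; apply: h.
Qed.

(** Induction on the backward word of [p]: its last letter is undone by a forward letter applied to
    [q], which keeps [q] on a forward orbit. *)
Lemma reach_neg_pos p q :
  reach (fun l => ~~ l.2) p -> reach (fun l => l.2) q -> ord p q.
Proof.
move=> rp; elim: rp q => [i|i|[i []] // {}p _ _ IH lp] q rq.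
- by apply: ord_sym; case: (reach_pos_turning i rq).
- by apply: ord_sym; case: (reach_pos_turning i rq).
apply: ord_step => //; first exact: reach_pos_turning.
by move=> lq; apply: IH; apply: reach_step.
Qed.

Lemma reach_neg_ends p l : reach (fun l => ~~ l.2) p -> ord_ends l p.
Proof. by move=> rp; split; apply: reach_neg_pos => //; [exact: reach_lo|exact: reach_hi]. Qed.

Hypothesis past : separates_past F.
Hypothesis past' : separates_past F'.

Lemma reach_neg_ord p q :
  reach (fun l => ~~ l.2) p -> reach (fun l => ~~ l.2) q -> ord p q.
Proof.
move=> rp; elim: rp q => [i|i|[i []] // {}p _ rp IH lp] q rq.
- by apply: ord_sym; apply: reach_neg_pos => //; apply: reach_lend.
- by apply: ord_sym; apply: reach_neg_pos => //; apply: reach_rend.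
have rip : reach (fun l => ~~ l.2) (step (i, false) p) by apply: reach_step.
(* With no backward letter left, the point is a turning point and hence on a forward orbit. *)
case: {q} rq => [j|j|[j []] // q _ rq lq].
- by apply: reach_neg_pos => //; apply: reach_lend.
- by apply: reach_neg_pos => //; apply: reach_rend.
have rjq : reach (fun l => ~~ l.2) (step (j, false) q) by apply: reach_step.
(* Equal last letters are stripped from both words; with different last letters the points lie in
   the two sets that separation in the past is about. *)
have [ij|ij] := eqVneq i j; first by subst j; apply/ord_steps => //; apply: IH.
have [Sp Sp'] := reach_neg_orbit_Sinv rp; have [Sq Sq'] := reach_neg_orbit_Sinv rq.
have negE (g : free_group n) : semigroup_inv g -> all (fun l => l.2 == false) (word g).
  by move/semigroup_inv_neg; apply: sub_all => -[k []].
apply: (@ord_separation _ _ F F' false [set r | reach (fun l => ~~ l.2) r]) => //.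
- by move=> l r l2 rr lr; apply: reach_step => //; rewrite l2.
- by move=> r k; apply: reach_neg_ends.
- by move=> r k; apply: reach_neg_ends.
- move=> /(past ij) h; case: h => [||g /negE gn gs]; last by exists g.
    by exists p.1 => //; split=> //; split; [exact: lp.1|].
  by exists q.1 => //; split=> //; split; [exact: lq.1|].
- move=> /(past' ij) h; case: h => [||g /negE gn gs]; last by exists g.
    by exists p.2 => //; split=> //; split; [exact: lp.2|].
  by exists q.2 => //; split=> //; split; [exact: lq.2|].
Qed.

Hypothesis future : separates_future F.
Hypothesis future' : separates_future F'.

(** Backward orbits serve as test points because they are stable under the pull-back that a forward
    step requires. The two orbit conditions are those of separation in the future. *)
Definition calibrated p : Prop :=
  [/\ orbit_G F p.1, orbit_G F' p.2 & forall q, reach (fun l => ~~ l.2) q -> ord p q].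

Lemma calibrated_reach_neg p : reach (fun l => ~~ l.2) p -> calibrated p.
Proof.
by move=> rp; have [? ?] := reach_orbit rp; split=> // q; apply: reach_neg_ord.
Qed.

Lemma calibrated_turning p i : calibrated p -> ord_ends (i, true) p.
Proof. by case=> _ _ h; split; apply: h; [exact: reach_lend|exact: reach_rend]. Qed.

Lemma calibrated_pos l p : l.2 -> calibrated p -> steppable l p ->
  calibrated (step l p).
Proof.
case: l => i [] // _ [op op' h] lp; split.
- by apply: orbit_letter => //; case: lp.
- by apply: orbit_letter => //; case: lp.
- move=> q rq; apply: ord_step => //; first exact: reach_neg_ends.
  by move=> lq; apply: h; apply: reach_step.
Qed.

(** Calibrated pairs are stable under forward steps and compare correctly with turning points, so
    [ord_separation] can follow them along a forward word. *)
Lemma calibrated_ord p q : calibrated p -> calibrated q -> ord p q.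
Proof.
move=> cp cq; have posE (g : free_group n) : semigroup g -> all (fun l => l.2 == true) (word g).
  by apply: sub_all => -[k []].
apply: (@ord_separation _ _ F F' true calibrated) => //.
- by move=> l r l2 cr lr; apply: calibrated_pos.
- by move=> r k; apply: calibrated_turning.
- by move=> r k; apply: calibrated_turning.
- by case: cp cq => p1 _ _ [q1 _ _] /(future p1 q1) [g /posE gp gs]; exists g.
- by case: cp cq => _ p1 _ [_ q1 _] /(future' p1 q1) [g /posE gp gs]; exists g.
Qed.

(* For a backward step, [p] is compared with forward images of the backward orbits
   of the turning points; these are calibrated, so [calibrated_ord] applies. *)
Lemma calibrated_step l p : calibrated p -> steppable l p -> calibrated (step l p).
Proof.
case: l => i [] cp lp; first exact: calibrated_pos.
have [op op' h] := cp; split.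
- by apply: orbit_letter => //; case: lp.
- by apply: orbit_letter => //; case: lp.
- move=> q /calibrated_reach_neg cq.
  apply: ord_step => //; first exact: calibrated_turning.
  by move=> lq; apply: calibrated_ord => //; apply: calibrated_pos.
Qed.

Lemma reach_ord p q : reach predT p -> reach predT q -> ord p q.
Proof.
have reach_calibrated r : reach predT r -> calibrated r.
  elim=> [i|i|l {}r _ _ IH lr]; last exact: calibrated_step.
    by apply: calibrated_reach_neg; apply: reach_lend.
  by apply: calibrated_reach_neg; apply: reach_rend.
by move=> /reach_calibrated cp /reach_calibrated; apply: calibrated_ord.
Qed.

End Kneading.

(** * Extension to closures *)

Section RealLine.
Local Open Scope classical_set_scope.
Local Open Scope ring_scope.
Set Implicit Arguments.
Unset Strict Implicit.
Variable R : realType.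
Implicit Types (x y z a b u v : R) (C K : set R) (P : set (R * R)).

Lemma closure_itvP C x :
  closure C x <-> (forall a b, a < x -> x < b -> exists2 u, C u & a < u < b).
Proof.
split=> [clx a b ax xb|h B /nbhs_ballP[e /= e0 eB]].
  have xab : x \in `]a, b[ by rewrite in_itv /= ax xb.
  by have [u [Cu]] := clx _ (near_in_itvoo xab); rewrite /= in_itv /=; exists u.
have [|| u Cu /andP[u1 u2]] := h (x - e) (x + e); [by lra|by lra|].
exists u; split=> //; apply: eB; rewrite /ball /= ltr_distlC; lra.
Qed.

Lemma closure_inf C : C !=set0 -> has_lbound C -> closure C (inf C).
Proof.
move=> C0 Cl; apply/closure_itvP => a b ai ib.
have [|u Cu ub] := @inf_adherent R C (b - inf C) _ (conj C0 Cl); first by lra.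
exists u => //; have := ge_inf Cl Cu; lra.
Qed.

Lemma closure_le C M x : (forall u, C u -> u <= M) -> closure C x -> x <= M.
Proof.
move=> CM /closure_itvP clx; rewrite leNgt; apply/negP => Mx.
have [|u /CM uM] := clx M (x + 1) Mx; first by lra.
lra.
Qed.

Lemma closure_ge C m x : (forall u, C u -> m <= u) -> closure C x -> m <= x.
Proof.
move=> Cm /closure_itvP clx; rewrite leNgt; apply/negP => xm.
have [|u /Cm um] := clx (x - 1) m _ xm; first by lra.
lra.
Qed.

(* Only one half of continuity; the other one follows by conjugating with the
   reflection of the line. *)
Lemma increasing_onto_upper K K' (phi : R -> R) x (e : R) :
  {in K &, {homo phi : x y / x < y}} -> closure K' `<=` phi @` K ->
  (forall z, K z -> K' (phi z)) -> K x -> 0 < e ->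
  exists2 b, x < b & forall z, K z -> z < b -> phi z < phi x + e.
Proof.
move=> inc onto KK' Kx e0.
have inc' z w : K z -> K w -> phi z < phi w -> z < w.
  move=> Kz Kw zw; case: (ltgtP z w) => // [wz|zw']; last by rewrite zw' ltxx in zw.
  by have := inc _ _ (mem_set Kw) (mem_set Kz) wz; rewrite ltNge ltW.
(* A value just above [phi x] has a preimage, which serves as the bound. *)
have [[w /= K'w xwe]|nw] := pselect (exists2 w, K' w & phi x < w < phi x + e).
  have [z0 Kz0 z0w] := onto _ (subset_closure K'w).
  exists z0; first by apply: inc' => //; rewrite z0w; case/andP: xwe.
  by move=> z Kz zz0; have := inc _ _ (mem_set Kz) (mem_set Kz0) zz0; rewrite z0w; lra.
(* No value lies strictly between [phi x] and [phi x + e]. If there are values above [phi x], their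
   infimum is attained since [phi] reaches the closure, and to the left of its preimage no value
   exceeds [phi x]. *)
pose E := [set w | K' w /\ phi x < w].
have [E0|E0] := pselect (E !=set0); last first.
  exists (x + 1); first by lra.
  move=> z Kz _; rewrite ltNge; apply/negP => xz; apply: E0.
  by exists (phi z); split; [exact: KK'|lra].
have El : lbound E (phi x + e).
  by move=> w [K'w xw]; rewrite leNgt; apply/negP => we; apply: nw; exists w => //; lra.
have Ehl : has_lbound E by exists (phi x + e).
have := lb_le_inf E0 El => iE.
have [|z0 Kz0 z0i] := onto (inf E).
  by apply: (closureS _ (closure_inf E0 Ehl)) => w [].
exists z0; first by apply: inc' => //; rewrite z0i; lra.
move=> z Kz zz0; have := inc _ _ (mem_set Kz) (mem_set Kz0) zz0; rewrite z0i.
move=> zi; have [|] := leP (phi z) (phi x); first by lra.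
by move=> xz; have := ge_inf Ehl (conj (KK' _ Kz) xz); rewrite leNgt zi.
Qed.

Lemma increasing_onto_continuous K K' (phi : R -> R) :
  {in K &, {homo phi : x y / x < y}} -> closure K' `<=` phi @` K ->
  (forall z, K z -> K' (phi z)) -> {within K, continuous phi}.
Proof.
move=> inc onto KK'; apply/subspace_continuousP => x Kx.
apply/cvgrPdist_lt => e e0.
have [b xb bP] := increasing_onto_upper inc onto KK' Kx e0.
have [|||||a xa aP] := @increasing_onto_upper [set z | K (- z)] [set z | K' (- z)]
  (fun z => - phi (- z)) (- x) e.
- by move=> z w /set_mem Kz /set_mem Kw zw; rewrite ltrN2 inc ?mem_set ?ltrN2.
- move=> y cly; have [|z Kz zy] := onto (- y).
    apply/closure_itvP => a' b' ay yb; move/closure_itvP: cly.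
    case/(_ (- b') (- a')); [by lra|by lra|move=> u /= Ku ub].
    by exists (- u) => //; lra.
  by exists (- z); rewrite /= ?opprK // zy opprK.
- by move=> z /= Kz; rewrite opprK; apply: KK'.
- by rewrite /= opprK.
- exact: e0.
have xab : x \in `](- a), b[ by rewrite in_itv /=; lra.
rewrite near_withinE; move: (near_in_itvoo xab); apply: filterS => z.
rewrite in_itv /= => /andP[az zb] Kz; rewrite ltr_distlC.
have := bP z Kz zb; have := aP (- z); rewrite /= !opprK => /(_ Kz).
rewrite ltrNl => /(_ az) h1 h2; apply/andP; split; last exact: h2.
have h3 : phi x - e < phi z by rewrite -ltrN2 opprB addrC.
exact: h3.
Qed.

Definition two_sided C : Prop := forall x, closure C x -> ~ C x ->
  (forall b, x < b -> exists2 u, C u & x < u < b) /\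
  (forall a, a < x -> exists2 u, C u & a < u < x).

(** Two distinct points of [C] are produced so that the comparison of their partners is strict in
    [two_sided_lt]. *)
Lemma two_sided_between C x y : two_sided C -> closure C x -> closure C y ->
  x < y -> exists u v, [/\ C u, C v, x <= u, u < v & v <= y].
Proof.
move=> C2 clx cly xy.
have [Cx|Cx] := pselect (C x); last first.
  have [h _] := C2 x clx Cx; have [v Cv xvy] := h y xy.
  have [|u Cu xuv] := h v; first by lra.
  by exists u, v; split=> //; lra.
have [Cy|Cy] := pselect (C y); first by exists x, y; split.
have [_ h] := C2 y cly Cy; have [v Cv xvy] := h x xy.
by exists x, v; split=> //; lra.
Qed.

(** The partner of a point outside [C] is a Dedekind cut: the supremum of the partners of the points
    of [C] below it. *)
Lemma two_sided_extend C C' P x : two_sided C ->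
  (forall p q, P p -> P q -> ord p q) -> (forall p, P p -> C p.1 /\ C' p.2) ->
  (forall u, C u -> exists u', P (u, u')) -> closure C x ->
  exists2 y, closure C' y & forall q, P q -> ord (x, y) q.
Proof.
move=> C2 Pord PC CP clx; have [Cx|Cx] := pselect (C x).
  have [y Pxy] := CP x Cx; exists y; last by move=> q; apply: Pord.
  by apply: subset_closure; have [] := PC _ Pxy.
have [right left] := C2 x clx Cx.
pose L := [set u' | exists2 u, P (u, u') & u < x].
have L0 : L !=set0.
  have [|u /CP[u' Pu] ux] := left (x - 1); first by lra.
  by exists u', u => //; lra.
have Lub u u' : P (u, u') -> x < u -> ubound L u'.
  move=> Pu xu y [w Pw wx]; have [h _] := Pord _ _ Pw Pu; rewrite ltW // -h /=.
  exact: lt_trans xu.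
have LC : L `<=` C' by move=> u' [u /PC[]].
have Lhub : has_ubound L.
  have [|u /CP[u' Pu] ux] := right (x + 1); first by lra.
  by exists u'; apply: (Lub u) => //; lra.
exists (sup L); first by apply: (closureS LC); apply: closure_sup.
move=> [u u'] Pu; rewrite /ord /=.
(* A further point of [C] strictly between [x] and [u] keeps the comparison with the supremum
   strict. *)
case: (ltgtP x u) => [xu|ux|xu]; last by have [] := PC _ Pu; rewrite -xu.
  have [v /CP[v' Pv] /andP[xv vu]] := right u xu.
  have vu' : v' < u' by have [<-] := Pord _ _ Pv Pu.
  have := ge_sup L0 (Lub _ _ Pv xv); move=> sv.
  by have h := le_lt_trans sv vu'; rewrite h (lt_gtF h).
have [v /CP[v' Pv] /andP[uv vx]] := left u ux.
have uv' : u' < v' by have [<-] := Pord _ _ Pu Pv.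
have sv : v' <= sup L by apply: ub_le_sup => //; exists v.
by have h := lt_le_trans uv' sv; rewrite h (lt_gtF h).
Qed.

Lemma two_sided_lt C P x y x' y' : two_sided C ->
  (forall p q, P p -> P q -> ord p q) ->
  (forall u, C u -> exists u', P (u, u')) -> closure C x -> closure C y ->
  (forall q, P q -> ord (x, x') q) -> (forall q, P q -> ord (y, y') q) ->
  x < y -> x' < y'.
Proof.
move=> C2 Pord CP clx cly ordx ordy xy.
have [u [v [/CP[u' Pu] /CP[v' Pv] xu uv vy]]] := two_sided_between C2 clx cly xy.
have uv' : u' < v' by have [<-] := Pord _ _ Pu Pv.
have xu' : x' <= u' by have [_] := ordx _ Pu; move: xu; rewrite /= !leNgt => ? <-.
have vy' : v' <= y' by have [] := ordy _ Pv; move: vy; rewrite /= !leNgt => ? <-.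
exact: le_lt_trans xu' (lt_le_trans uv' vy').
Qed.

End RealLine.

(** * Extreme points, gaps and closure of the critical orbit *)

Section Gaps.
Local Open Scope classical_set_scope.
Local Open Scope ring_scope.
Set Implicit Arguments.
Unset Strict Implicit.
Variables (R : realType) (n : nat) (F : system R n).
Implicit Types (l : letter n) (x y z u v : R).

(** Among the finitely many letter domains, which cover the orbit, the largest upper end is itself
    an orbit point. *)
Lemma orbit_max x : orbit_G F x ->
  exists2 M, orbit_G F M & forall u, orbit_G F u -> u <= M.
Proof.
case/orbit_in_letter_dom => l0 _.
case: (@Order.TotalTheory.arg_maxP _ _ _ l0 predT (letter_hi F) erefl) => l _ lmax.
exists (letter_hi F l); first exact: orbit_hi.
move=> u /orbit_in_letter_dom[m /letter_domP /andP[_ um]].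
exact: le_trans um (lmax m erefl).
Qed.

Lemma orbit_min x : orbit_G F x ->
  exists2 m, orbit_G F m & forall u, orbit_G F u -> m <= u.
Proof.
case/orbit_in_letter_dom => l0 _.
case: (@Order.TotalTheory.arg_minP _ _ _ l0 predT (letter_lo F) erefl) => l _ lmin.
exists (letter_lo F l); first exact: orbit_lo.
move=> u /orbit_in_letter_dom[m /letter_domP /andP[um _]].
exact: le_trans (lmin m erefl) um.
Qed.

(** Orbit points near [x] may lie outside the domain of the letter. Unless [x] is an orbit point,
    its image is interior to the range, so a neighbourhood clipped to the range can be pulled back;
    an orbit point found there is pushed forward. *)
Lemma closure_orbit_letter l x : closure (orbit_G F) x -> letter_dom F l x ->
  closure (orbit_G F) (letter_fun F l x).
Proof.
move=> clx lx; have [ox|nox] := pselect (orbit_G F x).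
  by apply: subset_closure; apply: orbit_letter.
have ly := letter_fun_dom lx; set y := letter_fun F l x in ly *.
have noy : ~ orbit_G F y.
  by move=> oy; apply: nox; rewrite -(letter_funK lx); apply: orbit_letter.
have /letter_domP/andP[loy yhi] := ly.
have loy' : letter_lo F (inv_letter l) < y.
  by rewrite lt_neqAle loy andbT; apply/eqP => h; apply: noy; rewrite -h; apply: orbit_lo.
have yhi' : y < letter_hi F (inv_letter l).
  by rewrite lt_neqAle yhi andbT; apply/eqP => h; apply: noy; rewrite h; apply: orbit_hi.
apply/closure_itvP => a b ay yb.
set lo := letter_lo F _ in loy loy' *; set hi := letter_hi F _ in yhi yhi' *.
pose a1 := Num.max a lo; pose b1 := Num.min b hi.
have a1y : a1 < y by rewrite gt_max ay.
have yb1 : y < b1 by rewrite lt_min yb.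
have a1d : letter_dom F (inv_letter l) a1.
  by apply/letter_domP; rewrite le_max lexx orbT /= (le_trans (ltW a1y)).
have b1d : letter_dom F (inv_letter l) b1.
  by apply/letter_domP; rewrite ge_min lexx orbT andbT (le_trans loy) // ltW.
suff [v ov /andP[v1 v2]] : exists2 v, orbit_G F v & a1 < v < b1.
  exists v => //; move: v1 v2; rewrite gt_max lt_min.
  by move=> /andP[-> _] /andP[-> _].
have fy : letter_fun F (inv_letter l) y = x := letter_funK lx.
have sd := letter_fun_dom a1d; have td := letter_fun_dom b1d.
have sK := letter_funK a1d; have tK := letter_funK b1d.
rewrite inv_letterK in sd sK; rewrite inv_letterK in td tK.
have between s' t' : s' < x -> x < t' -> letter_dom F l s' -> letter_dom F l t' ->
    exists u, [/\ orbit_G F u, letter_dom F l u & s' < u < t'].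
  move=> sx xt /letter_domP/andP[? ?] /letter_domP/andP[? ?].
  have [u ou /andP[? ?]] := (closure_itvP _ _).1 clx _ _ sx xt.
  by exists u; split=> //; [apply/letter_domP|]; lra.
have := letter_lt a1d ly; have := letter_lt ly b1d.
have := letter_lt b1d ly; have := letter_lt ly a1d.
rewrite fy a1y yb1 (lt_gtF a1y) (lt_gtF yb1) /=.
(* A decreasing letter exchanges the two pulled back ends. *)
case inc : (increasing F l.1) => h1 h2 h3 h4.
  have [|| u [ou lu /andP[su ut]]] := between _ _ _ _ sd td; [exact: h4|exact: h3|].
  exists (letter_fun F l u); first exact: orbit_letter.
  by rewrite -sK -tK !letter_lt // inc su.
have [|| u [ou lu /andP[su ut]]] := between _ _ _ _ td sd; [exact: h2|exact: h1|].
exists (letter_fun F l u); first exact: orbit_letter.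
by rewrite -sK -tK !letter_lt // inc su ut.
Qed.

(** An open interval missing the orbit also misses its closure. It is a whole component because any
    larger interval would contain [x] or [z], which lie in the closure. *)
Lemma gap_orbit x z : gap_ends_in_orbit F ->
  closure (orbit_G F) x -> closure (orbit_G F) z -> x < z ->
  (forall u, orbit_G F u -> ~ x < u < z) -> orbit_G F x /\ orbit_G F z.
Proof.
move=> gap clx clz xz noC; apply: gap => //.
have sub : `]x, z[%classic `<=` ~` closure (orbit_G F).
  move=> u /=; rewrite in_itv /= => /andP[xu uz] /closure_itvP /(_ x z xu uz)[v ov].
  exact: noC.
have mid : `]x, z[%classic ((x + z) / 2) by rewrite /= in_itv /=; lra.
exists ((x + z) / 2); first exact: sub.
apply/seteqP; split; last first.
  by apply: connected_component_max => //; apply/connected_intervalP; apply: interval_is_interval.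
have /connected_intervalP conn := @component_connected R (~` closure (orbit_G F)) ((x + z) / 2).
have compl := @connected_component_sub R (~` closure (orbit_G F)) ((x + z) / 2).
have midc := connected_component_refl (sub _ mid).
move=> w cw; rewrite /= in_itv /=.
have [wx|xw /=] := leP w x.
  by exfalso; apply: (compl x) => //; apply: (conn w ((x + z) / 2)) => //; rewrite wx /=; lra.
have [//|zw] := ltP w z.
by exfalso; apply: (compl z) => //; apply: (conn ((x + z) / 2) w) => //; rewrite zw andbT; lra.
Qed.

(** A point of the closure that is not a limit from one side ends a gap on that side, which puts it
    in the orbit. The extreme orbit points ensure that this gap is bounded. *)
Lemma orbit_two_sided : gap_ends_in_orbit F -> two_sided (orbit_G F).
Proof.
move=> gap x clx nox.
have /closure_itvP/(_ (x - 1) (x + 1))[||c oc _] := clx; [by lra|by lra|].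
split=> [b xb|a ax]; apply: contrapT => no.
  have [M oM Mmax] := orbit_max oc.
  have xM : x < M.
    rewrite lt_neqAle (closure_le Mmax clx) andbT; apply/eqP => h.
    by apply: nox; rewrite h.
  pose E := [set u | orbit_G F u /\ x < u].
  have E0 : E !=set0 by exists M.
  have El : lbound E b.
    by move=> u [ou xu]; rewrite leNgt; apply/negP => ub; apply: no; exists u; rewrite ?xu.
  have iE := lb_le_inf E0 El; have hE : has_lbound E by exists b.
  have [] // := @gap_orbit x (inf E) gap clx.
  - by apply: (closureS _ (closure_inf E0 hE)) => u [].
  - exact: lt_le_trans iE.
  - by move=> u ou /andP[xu]; rewrite ltNge ge_inf.
have [m om mmin] := orbit_min oc.
have mx : m < x.
  rewrite lt_neqAle (closure_ge mmin clx) andbT; apply/eqP => h.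
  by apply: nox; rewrite -h.
pose E := [set u | orbit_G F u /\ u < x].
have E0 : E !=set0 by exists m.
have El : ubound E a.
  by move=> u [ou xu]; rewrite leNgt; apply/negP => ub; apply: no; exists u; rewrite ?xu ?ub.
have iE := ge_sup E0 El; have hE : has_ubound E by exists a.
have [] // := @gap_orbit (sup E) x gap _ clx.
- by apply: (closureS _ (closure_sup E0 hE)) => u [].
- exact: le_lt_trans ax.
- by move=> u ou /andP[+ ux]; rewrite ltNge ub_le_sup.
Qed.

End Gaps.

(** * Conjugacies as sets of pairs *)

Section Conjugacy.
Local Open Scope classical_set_scope.
Local Open Scope ring_scope.
Set Implicit Arguments.
Unset Strict Implicit.
Variables (R : realType) (n : nat) (F F' : system R n).
Implicit Types (A B : set R) (Q : set (R * R)) (phi : R -> R).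

(** Common core of combinatorial equivalence, on the orbits, and of topological conjugacy, on their
    closures. *)
Definition conjugates A B phi : Prop :=
  [/\ set_bij A B phi,
      {in A &, {homo phi : x y / x < y}},
      (forall g, phi @` (A `&` Dom F g) = B `&` Dom F' g)
    & (forall g x, A x -> Dom F g x -> phi (act F g x) = act F' g (phi x))].

(** [Q] is the graph of the map: compatibility makes it single-valued, injective and increasing, and
    correct comparison with the ends of letter domains makes words apply in both systems at once. *)
Lemma conjugates_of_pairs A B Q :
  (forall x, A x <-> exists y, Q (x, y)) ->
  (forall y, B y <-> exists x, Q (x, y)) ->
  (forall p q, Q p -> Q q -> ord p q) ->
  (forall l p, Q p -> ord_ends F F' l p) ->
  (forall l p, Q p -> steppable F F' l p -> Q (step F F' l p)) ->
  exists2 phi, conjugates A B phi & forall x y, Q (x, y) -> phi x = y.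
Proof.
move=> AQ BQ Qord Qends Qstep; pose phi x := xget 0 [set y | Q (x, y)].
have phiQ x : A x -> Q (x, phi x) by move=> /AQ; apply: xgetPex.
have phiE x y : Q (x, y) -> phi x = y.
  move=> Qxy; have Qx : Q (x, phi x) by apply: phiQ; apply/AQ; exists y.
  exact: ord_functional (Qord _ _ Qx Qxy) erefl.
have Qword w p : Q p -> word_dom F w p.1 ->
    word_dom F' w p.2 /\ Q (word_fun F w p.1, word_fun F' w p.2).
  elim: w p => [|l w IH] [x y] Qp //= [lx wx].
  have lp := ord_ends_steppable (Qends l _ Qp) lx.
  by have [? ?] := IH _ (Qstep l _ Qp lp) wx; split=> //; split=> //; case: lp.
have Qword' w p : Q p -> word_dom F' w p.2 -> word_dom F w p.1.
  elim: w p => [|l w IH] [x y] Qp //= [lx wx].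
  have lp : steppable F F' l (x, y).
    by split=> //; apply/(ord_ends_dom (Qends l _ Qp)).
  by split; [case: lp|exact: (IH _ (Qstep l _ Qp lp))].
exists phi => //; split.
- split.
  + by move=> x /phiQ Qx; apply/BQ; exists x.
  + move=> x y /set_mem /phiQ Qx /set_mem /phiQ Qy.
    exact: (ord_injective (Qord _ _ Qx Qy)).
  + by move=> y /BQ[x Qxy]; exists x; [apply/AQ; exists y|exact: phiE].
- by move=> x y /set_mem /phiQ Qx /set_mem /phiQ Qy; have [/= ->] := Qord _ _ Qx Qy.
- move=> g; apply/seteqP; split=> [_ [x [/phiQ Qx gx] <-]|y [/BQ[x Qxy] gy]].
    by split; [apply/BQ; exists x|case: (Qword g _ Qx gx)].
  exists x; last exact: phiE.
  by split; [apply/AQ; exists y|exact: (Qword' g _ Qxy)].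
- by move=> g x /phiQ Qx gx; apply: phiE; case: (Qword g _ Qx gx).
Qed.

Lemma homo_le_lt A phi : set_inj A phi ->
  {in A &, {homo phi : x y / x <= y}} -> {in A &, {homo phi : x y / x < y}}.
Proof.
move=> inj inc x y Ax Ay; rewrite !lt_neqAle => /andP[xy /(inc _ _ Ax Ay) ->].
by rewrite andbT; apply: contraNN xy => /eqP /inj -> //.
Qed.

(** An increasing map from the part of [A] in the domain of a generator onto the corresponding part
    of [B] matches least with least and greatest with greatest points. *)
Lemma conjugates_turning A B phi : conjugates A B phi -> orbit_G F `<=` A ->
  orbit_G F' `<=` B ->
  forall i, phi (lend F i) = lend F' i /\ phi (rend F i) = rend F' i.
Proof.
case=> _ inc domg _ FA FB i; have := domg (fg_gen i).
have domE (G : system R n) : Dom G (fg_gen i) = dom G i.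
  by apply/seteqP; split=> x // [].
rewrite !domE => {}domg.
have inc' x y : A x -> A y -> x <= y -> phi x <= phi y.
  move=> Ax Ay; rewrite le_eqVlt => /predU1P[->//|xy].
  by apply: ltW; apply: inc => //; apply: mem_set.
have dI (G : system R n) x : dom G i x <-> lend G i <= x <= rend G i.
  by rewrite /dom /= in_itv.
have Al : A (lend F i) by apply: FA; apply: orbit_lend.
have Ar : A (rend F i) by apply: FA; apply: orbit_rend.
have Bl : B (lend F' i) by apply: FB; apply: orbit_lend.
have Br : B (rend F' i) by apply: FB; apply: orbit_rend.
have im x : A x -> dom F i x -> dom F' i (phi x).
  move=> Ax dx; have : (phi @` (A `&` dom F i)) (phi x) by exists x.
  by rewrite domg => -[].
have pre y : B y -> dom F' i y -> exists2 x, A x /\ dom F i x & phi x = y.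
  by move=> By dy; have : (B `&` dom F' i) y by []; rewrite -domg.
split; apply/le_anti/andP; split.
- have [x [Ax /dI/andP[lx _]] <-] := pre _ Bl (dom_lend F' i); exact: inc'.
- by have /dI/andP[] := im _ Al (dom_lend F i).
- by have /dI/andP[] := im _ Ar (dom_rend F i).
- have [x [Ax /dI/andP[_ xr]] <-] := pre _ Br (dom_rend F' i); exact: inc'.
Qed.

Hypothesis same_lend : forall i, lend F i = lend F' i.
Hypothesis same_rend : forall i, rend F i = rend F' i.

(** Since the intervals agree, [phi] fixes every turning point; it then carries domains of words and
    comparisons with interval ends from one system to the other. *)
Lemma conjugates_kneading A B phi : conjugates A B phi -> orbit_G F `<=` A ->
  orbit_G F' `<=` B -> same_kneading F F'.
Proof.
move=> conj FA FB c tc; have phiT := conjugates_turning conj FA FB.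
case: conj => -[phiB phiI _] inc dom phiA.
have phic : phi c = c.
  case: tc => i [] ->; have [l r] := phiT i; first by rewrite l same_lend.
  by rewrite r same_rend.
have Ac : A c by apply: FA; apply: orbit_turning.
have dom_c g : Dom F g c <-> Dom F' g c.
  split=> gc; first by have : (phi @` (A `&` Dom F g)) (phi c); [exists c|rewrite dom phic => -[]].
  have : (B `&` Dom F' g) (phi c) by split; [exact: phiB|rewrite phic].
  by rewrite -dom => -[x [Ax gx] /phiI <- //]; apply: mem_set.
split.
  by apply/seteqP; split=> g [gc gp]; split=> //; apply/dom_c.
move=> g [gc gp]; rewrite /itinerary -{2}phic -phiA //.
have og : orbit_G F (act F g c) by exists c, g.
move: (act F g c) og => x /FA Ax; apply/(@address_ord _ _ F F' (x, phi x)) => i.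
have inc' u v : A u -> A v -> (u < v) = (phi u < phi v).
  move=> Au Av; case: (ltgtP u v) => [uv|vu|->]; last by rewrite ltxx.
    by rewrite inc ?mem_set.
  by rewrite lt_gtF // inc ?mem_set.
have [/esym pl /esym pr] := phiT i.
have Al : A (lend F i) by apply: FA; apply: orbit_lend.
have Ar : A (rend F i) by apply: FA; apply: orbit_rend.
by split; split; rewrite /lo_pair /hi_pair /letter_lo /letter_hi /= ?pl ?pr -inc'.
Qed.

Hypothesis same_increasing : forall i, increasing F i = increasing F' i.
Hypothesis sep : separability F.
Hypothesis sep' : separability F'.
Hypothesis kneading : same_kneading F F'.

Notation P := (reach F F' predT).

Lemma orbit_pairs_ord p q : P p -> P q -> ord p q.
Proof. by case: sep sep' => ? ? [? ?]; apply: reach_ord. Qed.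

Lemma orbit_pairs_ends l p : P p -> ord_ends F F' l p.
Proof.
by move=> Pp; split; apply: orbit_pairs_ord => //; [exact: reach_lo|exact: reach_hi].
Qed.

Lemma orbit_pairs_orbit p : P p -> orbit_G F p.1 /\ orbit_G F' p.2.
Proof. exact: reach_orbit. Qed.

Lemma orbit_pairs_step l p : P p -> steppable F F' l p -> P (step F F' l p).
Proof. by move=> Pp; apply: reach_step. Qed.

Lemma orbit_pairs_left x : orbit_G F x -> exists y, P (x, y).
Proof.
case=> c [[w wr] [[i tc]]]; rewrite /G_at /Dom /act /= => wc ->.
have Pc : P (c, c).
  by case: tc => ->; rewrite {2}(same_lend, same_rend); [exact: reach_lend|exact: reach_rend].
(* The partner is generalised because steps may lead away from the diagonal pair [(c, c)]. *)
suff: forall c', P (c, c') -> exists y, P (word_fun F w c, y) by move/(_ c Pc).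
elim: w c wc {tc wr Pc} => [|l w IH] c /= wc c' Pc; first by exists c'.
case: wc => lc wc.
have lp := ord_ends_steppable (orbit_pairs_ends l Pc) lc.
exact: IH wc _ (orbit_pairs_step Pc lp).
Qed.

Lemma orbit_pairs_right y : orbit_G F' y -> exists x, P (x, y).
Proof.
case=> c [[w wr] [[i tc]]]; rewrite /G_at /Dom /act /= => wc ->.
have Pc : P (c, c).
  by case: tc => ->; rewrite -{1}(same_lend, same_rend); [exact: reach_lend|exact: reach_rend].
suff: forall c', P (c', c) -> exists x, P (x, word_fun F' w c) by move/(_ c Pc).
elim: w c wc {tc wr Pc} => [|l w IH] c' /= wc c Pc; first by exists c.
case: wc => lc wc.
have lp : steppable F F' l (c, c').
  by split=> //; apply/(ord_ends_dom (orbit_pairs_ends l Pc)).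
exact: IH wc _ (orbit_pairs_step Pc lp).
Qed.

Lemma orbit_conjugates : exists2 phi, conjugates (orbit_G F) (orbit_G F') phi &
  forall i, phi (lend F i) = lend F' i /\ phi (rend F i) = rend F' i.
Proof.
have [|||||phi phiC phiE] := @conjugates_of_pairs (orbit_G F) (orbit_G F') P.
- by move=> x; split=> [|[y /orbit_pairs_orbit[]]]; first exact: orbit_pairs_left.
- by move=> y; split=> [|[x /orbit_pairs_orbit[]]]; first exact: orbit_pairs_right.
- exact: orbit_pairs_ord.
- by move=> l p; apply: orbit_pairs_ends.
- by move=> l p; apply: orbit_pairs_step.
by exists phi => // i; split; apply: phiE; [exact: reach_lend|exact: reach_rend].
Qed.

Hypothesis gap : gap_ends_in_orbit F.
Hypothesis gap' : gap_ends_in_orbit F'.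

(** Two points are matched when they cut the set of orbit pairs at the same place; the gap
    hypotheses make the partner exist and be unique. *)
Definition closure_pairs : set (R * R) :=
  [set p | [/\ closure (orbit_G F) p.1, closure (orbit_G F') p.2 &
               forall q, P q -> ord p q]].

(** Orbit pairs read from [F'] to [F], so that the extension lemmas apply in the opposite
    direction. *)
Let P' : set (R * R) := [set p | P (p.2, p.1)].

Let P'ord p q : P' p -> P' q -> ord p q.
Proof. by case: p q => ? ? [? ?] h k; apply/ord_swap; apply: orbit_pairs_ord. Qed.

Lemma closure_pairs_left x : closure (orbit_G F) x -> exists y, closure_pairs (x, y).
Proof.
move=> clx.
have [||||y cly h] := @two_sided_extend _ _ (orbit_G F') P x (orbit_two_sided gap) => //.
- exact: orbit_pairs_ord.
- exact: orbit_pairs_orbit.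
- exact: orbit_pairs_left.
by exists y.
Qed.

Lemma closure_pairs_right y : closure (orbit_G F') y -> exists x, closure_pairs (x, y).
Proof.
move=> cly.
have [||||x clx h] := @two_sided_extend _ _ (orbit_G F) P' y (orbit_two_sided gap') => //.
- by move=> p /orbit_pairs_orbit[].
- exact: orbit_pairs_right.
exists x; split=> // -[u v] Puv; apply/ord_swap; exact: (h (v, u)).
Qed.

Lemma closure_pairs_ord p q : closure_pairs p -> closure_pairs q -> ord p q.
Proof.
move: p q; suff h p q : closure_pairs p -> closure_pairs q -> (p.1 < q.1) = (p.2 < q.2).
  by move=> p q cp cq; split; apply: h.
case: p q => x x' [y y'] [/= clx clx' ordx] [/= cly cly' ordy]; apply/idP/idP.
  apply: (two_sided_lt (orbit_two_sided gap) orbit_pairs_ord orbit_pairs_left) => //.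
apply: (@two_sided_lt _ _ P' _ _ _ _ (orbit_two_sided gap') P'ord) => //.
- exact: orbit_pairs_right.
- by move=> [v u] Puv; apply/ord_swap; exact: (ordx (u, v)).
- by move=> [v u] Puv; apply/ord_swap; exact: (ordy (u, v)).
Qed.

Lemma closure_pairs_ends l p : closure_pairs p -> ord_ends F F' l p.
Proof. by case=> _ _ h; split; apply: h; [exact: reach_lo|exact: reach_hi]. Qed.

Lemma closure_pairs_step l p : closure_pairs p -> steppable F F' l p ->
  closure_pairs (step F F' l p).
Proof.
move=> [clp clp' h] lp; split.
- by apply: closure_orbit_letter => //; case: lp.
- by apply: closure_orbit_letter => //; case: lp.
- move=> q Pq; apply: ord_step => //; first exact: orbit_pairs_ends.
  by move=> lq; apply: h; apply: orbit_pairs_step.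
Qed.

Lemma closure_conjugates : exists phi,
  conjugates (closure (orbit_G F)) (closure (orbit_G F')) phi.
Proof.
have [|||||phi phiC _] := @conjugates_of_pairs (closure (orbit_G F))
  (closure (orbit_G F')) closure_pairs; last by exists phi.
- by move=> x; split=> [|[y []]]; first exact: closure_pairs_left.
- by move=> y; split=> [|[x []]]; first exact: closure_pairs_right.
- exact: closure_pairs_ord.
- by move=> l p; apply: closure_pairs_ends.
- by move=> l p; apply: closure_pairs_step.
Qed.

End Conjugacy.

(** * Increasing bijections of closed sets and invariance *)

Section Closures.
Local Open Scope classical_set_scope.
Local Open Scope ring_scope.
Set Implicit Arguments.
Unset Strict Implicit.
Variable R : realType.
Implicit Types (K : set R) (phi : R -> R).

(** The map and its inverse are both increasing and onto closed sets, so
    [increasing_onto_continuous] applies to each. *)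
Lemma increasing_bij_homeomorphism K K' phi : closed K -> closed K' ->
  set_bij K K' phi -> {in K &, {homo phi : x y / x < y}} ->
  homeomorphism K K' phi.
Proof.
move=> Kcl K'cl bij inc; have [KK' inj onto] := bij.
have pK : {in K', cancel ('pinv_(fun=> 0) K phi) phi} by apply: surjpK.
have [K'K _ onto'] : set_bij K' K ('pinv_(fun=> 0) K phi) by apply: bijpinv_bij.
split=> //; apply: increasing_onto_continuous.
- exact: inc.
- by move=> y /K'cl; apply: onto.
- exact: KK'.
- move=> x y K'x K'y xy; case: ltgtP => // [yx|yx]; last first.
    by have := congr1 phi yx; rewrite !pK // => h; rewrite h ltxx in xy.
  have Ky := mem_set (K'K _ (set_mem K'y)); have Kx := mem_set (K'K _ (set_mem K'x)).
  by have := inc _ _ Ky Kx yx; rewrite !pK // ltNge ltW.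
- by move=> x /Kcl; apply: onto'.
- exact: K'K.
Qed.

End Closures.

Lemma closure_orbit_invariant (R : realType) (n : nat) (F : system R n) :
  invariant_set F (closure (orbit_G F)).
Proof.
move=> g y [x [clx]]; rewrite /Dom /act => + <-.
elim: (word g) x clx => [|l w IH] x clx //= [lx wx].
by apply: IH => //; apply: closure_orbit_letter.
Qed.

Theorem theorem1p1 (R : realType) (n : nat) (F F' : system R n)
    (same_dom : forall i : 'I_n, dom F i = dom F' i)
    (same_sigma : forall i : 'I_n, sigma F i = sigma F' i)
    (sepF : separability F) (sepF' : separability F') :
  (comb_equivalent F F' <-> same_kneading F F') /\
  (gap_ends_in_orbit F -> gap_ends_in_orbit F' ->
   (top_conjugate F (closure (orbit_G F)) F' (closure (orbit_G F'))
    <-> same_kneading F F')).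
Proof.
have same_inc i : increasing F i = increasing F' i.
  have := same_sigma i; rewrite !sigmaE.
  by case: increasing; case: increasing.
(* Equal intervals contain each other's ends, whence equal ends by antisymmetry. *)
have dom_le (G H : system R n) i : dom G i = dom H i ->
    (lend H i <= lend G i /\ rend G i <= rend H i)%R.
  move=> GH; have := dom_lend G i; have := dom_rend G i; rewrite GH /dom /= !in_itv /=.
  by move=> /andP[_ ->] /andP[].
have same_lend i : lend F i = lend F' i.
  by apply/le_anti/andP; split; [case: (dom_le F' F i)|case: (dom_le F F' i)].
have same_rend i : rend F i = rend F' i.
  by apply/le_anti/andP; split; [case: (dom_le F F' i)|case: (dom_le F' F i)].
split; last move=> gap gap'; split.
- case=> _ [phi [bij inc _ dom phiA]].
  apply: (@conjugates_kneading _ _ F F' same_lend same_rend (orbit_G F) (orbit_G F') phi) => //.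
  split=> //.
  + by apply: homo_le_lt => //; case: bij.
  + by move=> g; rewrite setIC dom setIC.
  + by move=> g x ox gx; apply: phiA.
- move=> kn; split=> //.
  have [phi [bij inc dom phiA] phiT] := orbit_conjugates same_lend same_rend same_inc sepF sepF' kn.
  exists phi; split=> //.
  + by move=> x y ox oy; rewrite le_eqVlt => /predU1P[->//|xy]; apply/ltW/inc.
  + by move=> g; rewrite setIC dom setIC.
  + by move=> g x gx ox; apply: phiA.
- case=> _ _ _ [phi [[bij _ _] inc dom phiA]].
  apply: (@conjugates_kneading _ _ F F' same_lend same_rend
    (closure (orbit_G F)) (closure (orbit_G F')) phi); [|exact: subset_closure..].
  by split=> //; apply: homo_le_lt => //; case: bij.
- move=> kn; have [phi [bij inc dom phiA]] :=
    closure_conjugates same_lend same_rend same_inc sepF sepF' kn gap gap'.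
  split=> //; [exact: closure_orbit_invariant..|exists phi; split=> //].
  + by apply: increasing_bij_homeomorphism => //; apply: closed_closure.
  + by move=> x y ox oy; rewrite le_eqVlt => /predU1P[->//|xy]; apply/ltW/inc.
Qed.
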